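(* The following iterative rounding algorithm can be implemented to run in polynomial time. Input: a graph $G=(V,E)$ with vertex costs $c:V\to\mathbb{R}_{\ge0}$. Initialize $H_0=G$, $R_0=\emptyset$, $i=0$. While $H_i$ contains a cycle: let $x^{(i)}$ be the vector returned by the subroutine Produce-Witness on $(H_i,c)$, let $A_i=\{u\in V(H_i):x^{(i)}_u\ge 1/2\}$, set $R_{i+1}=R_i\cup A_i$ and $H_{i+1}=H_i-A_i$, and increment $i$. Return $R_i$.
   Context: Graphs are finite, undirected, simple and loopless. For $S\subseteq V$, $E[S]$ is the edge set of the induced subgraph $G[S]$ and $d_S(u)$ the degree of $u$ in $G[S]$. The strong density polyhedron is $$P_{SD}(G)=\Big\{x\in[0,1]^V:\ \sum_{u\in S}(d_S(u)-1)x_u\ge |E[S]|-|S|+1\quad\text{for all } S\subseteq V \text{ with } E[S]\neq\emptyset\Big\}.$$ Produce-Witness is a polynomial-time subroutine that, given a graph $H=(W,F)$ containing a cycle and non-negative vertex costs $c$, returns a vector $x^*\in\mathbb{R}^W_{\ge0}$ such that (i) $c^Tx^*\le\min\{c^Tx:x\in P_{SD}(H)\}$; (ii) there exists $u\in W$ with $x^*_u\ge1/2$; (iii) for $A=\{u\in W:x^*_u\ge1/2\}$, the restriction of $x^*$ to $W\setminus A$ lies in $P_{SD}(H-A)$. For running time statements, costs are rational and time is measured in the encoding length of the input. *)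

(* Defs.v *)
From Corelib Require Import BinNums.
From mathcomp Require Import all_boot all_order all_algebra.
From mathcomp Require Import reals.

Set Implicit Arguments.
Unset Strict Implicit.
Unset Printing Implicit Defensive.

Import Order.TTheory GRing.Theory Num.Theory.
Local Open Scope ring_scope.

(* A finite simple graph with vertex set [vset] contained in the finite type
   [T]; the ambient type is fixed so that deleting vertices keeps the type. *)
Record sgraph (T : finType) := SGraph {
  vset : {set T};
  adj : rel T;
  adj_sym : symmetric adj;
  adj_irr : irreflexive adj;
  adj_vset : forall u v, adj u v -> u \in vset
}.

Section Graphs.
Variable T : finType.
Implicit Types (H : sgraph T) (A S : {set T}).

Definition del_adj H A : rel T :=
  fun u v => [&& u \notin A, v \notin A & adj H u v].

Fact del_adj_sym H A : symmetric (del_adj H A).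
Proof. by move=> u v; rewrite /del_adj adj_sym andbCA. Qed.

Fact del_adj_irr H A : irreflexive (del_adj H A).
Proof. by move=> u; rewrite /del_adj adj_irr !andbF. Qed.

Fact del_adj_vset H A u v : del_adj H A u v -> u \in vset H :\: A.
Proof. by case/and3P=> uA _ /adj_vset uH; rewrite inE uA uH. Qed.

Definition del H A : sgraph T :=
  SGraph (@del_adj_sym H A) (@del_adj_irr H A) (@del_adj_vset H A).

Definition has_cycle H : Prop :=
  exists2 s : seq T, ucycle (adj H) s & (2 < size s)%N.

Definition edges_in H S : {set {set T}} :=
  [set [set u; v] | u in S, v in S & adj H u v].

Definition deg_in H S (u : T) : nat := #|[set v in S | adj H u v]|.

(* Vectors indexed by the vertices of [H] are functions on [T] of which only
   the values on [vset H] are ever used. *)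
Definition strong_density (R : realFieldType) H (x : T -> R) : Prop :=
  (forall u, u \in vset H -> 0 <= x u <= 1) /\
  (forall S, S \subset vset H -> edges_in H S != set0 ->
     #|edges_in H S|%:R - #|S|%:R + 1 <=
       \sum_(u in S) ((deg_in H S u)%:R - 1) * x u).

Definition nonneg H (c : T -> rat) : Prop :=
  forall u, u \in vset H -> 0 <= c u.

Definition rounded H (x : T -> rat) : {set T} :=
  [set u in vset H | 1 / 2 <= x u].

Definition witness (R : realFieldType) H (c x : T -> rat) : Prop :=
  [/\ nonneg H x,
      forall y : T -> R, strong_density H y ->
        \sum_(u in vset H) ratr (c u) * ratr (x u) <=
          \sum_(u in vset H) ratr (c u) * y u,
      exists2 u, u \in vset H & 1 / 2 <= x u
    & strong_density (del H (rounded H x)) (fun u => ratr (x u) : R)].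

Variables (pw : sgraph T -> (T -> rat) -> T -> rat) (c : T -> rat).

Definition round_step (st : sgraph T * {set T}) : sgraph T * {set T} :=
  let A := rounded st.1 (pw st.1 c) in (del st.1 A, st.2 :|: A).

Definition round_state (G : sgraph T) (i : nat) : sgraph T * {set T} :=
  iter i round_step (G, set0).

Definition rounding_returns (G : sgraph T) (S : {set T}) : Prop :=
  exists i, [/\ forall j, (j < i)%N -> has_cycle (round_state G j).1,
                ~ has_cycle (round_state G i).1
              & S = (round_state G i).2].

End Graphs.

(* The machine model: a while language whose data are binary trees.  A program
   maps the current tree to a new one; [Leaf] stands for false (and nil), any
   other tree for true.  Every primitive step is charged the sizes of the trees
   it reads and writes, and every copy that is made or kept of the current tree
   is charged its size.  A Turing machine working on the usual linear notation
   for trees thus simulates a run with polynomial overhead, and conversely. *)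

Inductive tree := Leaf | Node of tree & tree.

Fixpoint tree_size (t : tree) : nat :=
  if t is Node a b then (tree_size a + tree_size b).+1 else 1.

Definition ttrue : tree := Node Leaf Leaf.

Inductive prog :=
| PId
| PNil
| PHd
| PTl
| PEq
| PPair of prog & prog
| PSeq of prog & prog
| PIf of prog & prog & prog
| PWhile of prog & prog.

(* [prim p s t]: the primitive [p] turns [s] into [t]. *)
Inductive prim : prog -> tree -> tree -> Prop :=
| prim_id s : prim PId s s
| prim_nil s : prim PNil s Leaf
| prim_hd a b : prim PHd (Node a b) a
| prim_hd0 : prim PHd Leaf Leaf
| prim_tl a b : prim PTl (Node a b) b
| prim_tl0 : prim PTl Leaf Leaf
| prim_eq a : prim PEq (Node a a) ttrue
| prim_neq a b : a <> b -> prim PEq (Node a b) Leaf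
| prim_eq0 : prim PEq Leaf Leaf.

(* [exec p s t k]: on [s], [p] halts with result [t] in time [k]. *)
Inductive exec : prog -> tree -> tree -> nat -> Prop :=
| exec_prim p s t :
    prim p s t -> exec p s t (tree_size s + tree_size t)
| exec_pair p q s a b k l :
    exec p s a k -> exec q s b l ->
    exec (PPair p q) s (Node a b) (k + l + tree_size s + tree_size (Node a b))
| exec_seq p q s t r k l :
    exec p s t k -> exec q t r l ->
    exec (PSeq p q) s r (k + l)
| exec_ift p q r s a b t k l :
    exec p s (Node a b) k -> exec q s t l ->
    exec (PIf p q r) s t (k + l + tree_size s)
| exec_iff p q r s t k l :
    exec p s Leaf k -> exec r s t l ->
    exec (PIf p q r) s t (k + l + tree_size s)
| exec_while_stop p q s k :
    exec p s Leaf k ->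
    exec (PWhile p q) s s (k + tree_size s)
| exec_while_loop p q s a b s' t k l m :
    exec p s (Node a b) k -> exec q s s' l -> exec (PWhile p q) s' t m ->
    exec (PWhile p q) s t (k + l + m + tree_size s).

(* Some program, on the encoding of any [a] in the domain [D], halts with a
   result satisfying [spec a], in time polynomial in the encoding length. *)
Definition polytime (A : Type) (enc : A -> tree) (D : A -> Prop)
    (spec : A -> tree -> Prop) : Prop :=
  exists (p : prog) (q : {poly nat}), forall a, D a ->
    exists t k, [/\ exec p (enc a) t k, spec a t
                  & (k <= q.[tree_size (enc a)])%N].

(* Numbers are encoded in binary, least significant bit first, the leading 1
   being implicit. *)
Fixpoint enc_pos (p : positive) : tree :=
  match p with
  | xH => Leaf
  | xO p' => Node Leaf (enc_pos p')
  | xI p' => Node ttrue (enc_pos p')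
  end.

Definition enc_nat (n : nat) : tree :=
  if bin_of_nat n is Npos p then Node Leaf (enc_pos p) else Leaf.

Definition enc_int (z : int) : tree :=
  match z with
  | Posz n => Node Leaf (enc_nat n)
  | Negz n => Node ttrue (enc_nat n.+1)
  end.

Definition enc_rat (q : rat) : tree :=
  Node (enc_int (numq q)) (enc_nat `|denq q|%N).

Definition enc_seq (X : Type) (enc : X -> tree) (s : seq X) : tree :=
  foldr (fun x t => Node (enc x) t) Leaf s.

Definition enc_set n (S : {set 'I_n}) : tree :=
  enc_seq (fun u : 'I_n => enc_nat u) (enum S).

Definition enc_vector n (H : sgraph 'I_n) (x : 'I_n -> rat) : tree :=
  enc_seq (fun u : 'I_n => Node (enc_nat u) (enc_rat (x u))) (enum (vset H)).

Definition enc_edges n (H : sgraph 'I_n) : tree :=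
  enc_seq (fun e : 'I_n * 'I_n => Node (enc_nat e.1) (enc_nat e.2))
    (enum [pred e : 'I_n * 'I_n | (e.1 < e.2)%N && adj H e.1 e.2]).

(* A graph with rational vertex costs, its vertices being natural numbers.
   The bound [label_bound] on the vertex names is not part of the encoding, nor
   are the costs outside the vertex set. *)
Record instance := Instance {
  label_bound : nat;
  graph_of : sgraph 'I_label_bound;
  cost_of : 'I_label_bound -> rat
}.

Arguments cost_of : clear implicits.

Definition enc_instance (I : instance) : tree :=
  Node (enc_vector (graph_of I) (cost_of I)) (enc_edges (graph_of I)).

(* Main.v *)
Require Import Defs.
From Corelib Require Import BinNums.
From mathcomp Require Import all_boot all_order all_algebra.
From mathcomp Require Import reals.
From mathcomp Require Import zify.

(* Each witness has an entry at least 1/2, so every round deletes a vertex and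
   there are at most |V| rounds; the residual instances are no longer than the
   input, so each call of the subroutine takes time polynomial in the length of
   the input.  Acyclicity is tested by repeatedly discarding the edges one of
   whose endpoints lies on no other edge: cycles survive, and if something is
   left, every walk can be continued without turning back, hence closes a cycle. *)

Set Implicit Arguments.
Unset Strict Implicit.
Unset Printing Implicit Defensive.

Import Order.TTheory GRing.Theory Num.Theory.

(** * Polynomial time on trees *)

(** Polynomial time is not preserved by iteration: a body that duplicates its argument is
    polynomial, yet linearly many passes produce exponential size. Every loop here therefore works
    on a state whose encoding never grows and whose measure, bounded by the length of that encoding,
    drops in each pass. For the rounding loop this means that the numbers in a witness serve the
    threshold test only; the next instance is cut out of the current one by filtering lists. Outside
    the closure lemmas no program is written down: they assemble one from functions on abstract
    data, and correctness becomes an equation between trees. *)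

Definition pval (q : {poly nat}) (n : nat) : nat := q.[n]%R.

Section PolyNat.
Implicit Types (p q : {poly nat}) (m n : nat).

Lemma pvalE p n : p.[n]%R = pval p n.
Proof. by []. Qed.

Lemma pvalD p q n : pval (p + q)%R n = pval p n + pval q n.
Proof. exact: hornerD. Qed.

Lemma pvalM p q n : pval (p * q)%R n = pval p n * pval q n.
Proof. exact: hornerM. Qed.

Lemma pvalC m n : pval (m%:P)%R n = m.
Proof. exact: hornerC. Qed.

Lemma pvalX n : pval 'X%R n = n.
Proof. exact: hornerX. Qed.

Definition pval_simp := (pvalD, pvalM, pvalC, pvalX).

Lemma pval_comp p q n : pval (p \Po q)%R n = pval p (pval q n).
Proof. exact: horner_comp. Qed.

(** Coefficients are natural numbers, so Horner's scheme is monotone; a time bound may thus be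
    evaluated at any upper bound for the length of the data. *)
Lemma leq_pval p m n : m <= n -> pval p m <= pval p n.
Proof.
move=> le_mn; elim/poly_ind: p => [|p c IH]; first by rewrite /pval !horner0.
by rewrite !pval_simp leq_add2r leq_mul.
Qed.

End PolyNat.

Lemma tree_size_gt0 t : 0 < tree_size t.
Proof. by case: t. Qed.

(** Every step pays for the tree it writes or keeps. This bounds intermediate results and so makes
    composition polynomial. *)
Lemma exec_size p s t k : exec p s t k -> tree_size t <= k.
Proof. by elim=> //= *; lia. Qed.

(** The argument stays abstract while the result is a bare tree, so several components computed from
    one [x] can be combined without choosing a type for each intermediate result. *)
Definition ptime (X : Type) (e : X -> tree) (D : X -> Prop) (f : X -> tree) :=
  polytime e D (fun x t => t = f x).

Lemma polytimeE X (e : X -> tree) D S : polytime e D S ->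
  exists p q, forall x, D x -> exists t k,
    [/\ exec p (e x) t k, S x t & k <= pval q (tree_size (e x))].
Proof. by []. Qed.

Lemma ptimeE X (e : X -> tree) D f : ptime e D f ->
  exists p q, forall x, D x ->
    exists2 k, exec p (e x) (f x) k & k <= pval q (tree_size (e x)).
Proof.
move=> [p [q Hp]]; exists p, q => x /Hp[t [k [ex tf lek]]].
by exists k; rewrite -?tf.
Qed.

Definition enc_bool (b : bool) : tree := if b then ttrue else Leaf.

(** * Closure properties of polynomial time *)

Section Closure.

Lemma polytime_comp X Y (e : X -> tree) (e' : Y -> tree) D D'
    (R : X -> Y -> Prop) S :
  polytime e D (fun x t => exists2 y, R x y & t = e' y) ->
  (forall x y, D x -> R x y -> D' y) ->
  polytime e' D' S ->
  polytime e D (fun x t => exists2 y, R x y & S y t).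
Proof.
move=> /polytimeE[p [q Hp]] DD' /polytimeE[p' [q' Hp']].
exists (PSeq p p'), (q + (q' \Po q))%R => x Dx.
have [t [k [ext [y Rxy ty] leq]]] := Hp x Dx.
have [t' [k' [ext' Syt leq']]] := Hp' y (DD' _ _ Dx Rxy).
exists t', (k + k'); split; last 1 first.
- rewrite pvalE pvalD pval_comp leq_add // (leq_trans leq') //.
  by apply: leq_pval; rewrite -ty (leq_trans (exec_size ext)).
- by apply: exec_seq ext _; rewrite ty.
- by exists y.
Qed.

Lemma polytime_sub X (e : X -> tree) (D D' : X -> Prop)
    (S S' : X -> tree -> Prop) :
  (forall x, D' x -> D x) -> (forall x t, D' x -> S x t -> S' x t) ->
  polytime e D S -> polytime e D' S'.
Proof.
move=> DD SS [p [q Hp]]; exists p, q => x Dx.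
by have [t [k [? ? ?]]] := Hp x (DD x Dx); exists t, k; split; auto.
Qed.

Section Fixed.
Variables (X : Type) (e : X -> tree) (D : X -> Prop).
Implicit Types (f g : X -> tree) (b : X -> bool).
Local Notation pt := (ptime e D).

Lemma eq_ptime f g : (forall x, D x -> f x = g x) -> pt f -> pt g.
Proof. by move=> fg Hf; apply: polytime_sub Hf => // x t /fg <- ->. Qed.

Lemma ptime_comp Y (e' : Y -> tree) D' (h : X -> Y) (g : Y -> tree) :
  pt (e' \o h) -> (forall x, D x -> D' (h x)) -> ptime e' D' g -> pt (g \o h).
Proof.
move=> Hh DD' Hg.
have Hh' : polytime e D (fun x t => exists2 y, y = h x & t = e' y).
  by apply: polytime_sub Hh => // x t _ ->; exists (h x).
apply: polytime_sub (polytime_comp Hh' _ Hg) => // [x t _ [y -> ->] //|x y Dx ->].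
exact: DD'.
Qed.

Lemma ptime_prim p f g :
  pt f -> (forall x, D x -> prim p (f x) (g x)) -> pt g.
Proof.
(* With [f] itself as the encoding only one primitive is left to run. The 3 in the bound is the size
   of [ttrue] and covers the constant outputs. *)
move=> Hf Hp; apply: (@ptime_comp X f D id g) => //.
exists p, (('X + 3%N%:P) * 2%N%:P)%R => x Dx.
exists (g x), (tree_size (f x) + tree_size (g x)); split => //.
  exact/exec_prim/Hp.
by rewrite pvalE !pval_simp; case: (Hp x Dx) => /= *; lia.
Qed.

Lemma ptime_id : pt e.
Proof.
exists PId, ('X * 2%N%:P)%R => x _; exists (e x), (tree_size (e x) + tree_size (e x)).
by split=> //; [exact/exec_prim/prim_id | rewrite pvalE !pval_simp; lia].
Qed.

Lemma ptime_leaf : pt (fun=> Leaf).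
Proof. by apply: (ptime_prim ptime_id) => x _; apply: prim_nil. Qed.

Lemma ptime_hd f g : pt (fun x => Node (f x) (g x)) -> pt f.
Proof. by move=> H; apply: (ptime_prim H) => x _; apply: prim_hd. Qed.

Lemma ptime_tl f g : pt (fun x => Node (f x) (g x)) -> pt g.
Proof. by move=> H; apply: (ptime_prim H) => x _; apply: prim_tl. Qed.

Lemma ptime_pair f g : pt f -> pt g -> pt (fun x => Node (f x) (g x)).
Proof.
move=> /ptimeE[p [q Hp]] /ptimeE[p' [q' Hp']].
exists (PPair p p'), ((q + q') * 2%N%:P + 'X + 1%N%:P)%R => x Dx.
have [k ex le_k] := Hp x Dx; have [l ex' le_l] := Hp' x Dx.
have /= := (exec_size ex, exec_size ex') => -[sk sl].
by eexists; eexists; split; [apply: exec_pair ex ex' | | rewrite pvalE !pval_simp /=; lia].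
Qed.

Lemma ptime_true : pt (fun=> ttrue).
Proof. exact: ptime_pair ptime_leaf ptime_leaf. Qed.

Lemma ptime_eq b f g :
  (forall x, D x -> reflect (f x = g x) (b x)) ->
  pt f -> pt g -> pt (fun x => enc_bool (b x)).
Proof.
move=> Hb Hf Hg; apply: (@ptime_prim PEq _ _ (ptime_pair Hf Hg)) => x Dx /=.
by case: Hb => // [->|]; [apply: prim_eq | apply: prim_neq].
Qed.

End Fixed.

Section If.
Variables (X : Type) (e : X -> tree) (D : X -> Prop) (b : X -> bool).

(** Each branch is required only where the test selects it, so a test can secure the precondition of
    a branch. *)
Lemma ptime_if f g :
  ptime e D (fun x => enc_bool (b x)) ->
  ptime e (fun x => D x /\ b x) f -> ptime e (fun x => D x /\ ~~ b x) g ->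
  ptime e D (fun x => if b x then f x else g x).
Proof.
move=> /ptimeE[p [q Hp]] /ptimeE[p1 [q1 Hp1]] /ptimeE[p2 [q2 Hp2]].
exists (PIf p p1 p2), (q + q1 + q2 + 'X)%R => x Dx.
have [k /= ex le_k] := Hp x Dx.
case bx: (b x); rewrite bx in ex.
  have [l ex1 le_l] := Hp1 x (conj Dx bx).
  by eexists; eexists; split; [apply: exec_ift ex ex1 | | rewrite pvalE !pval_simp; lia].
have [l ex1 le_l] := Hp2 x (conj Dx (negbT bx)).
by eexists; eexists; split; [apply: exec_iff ex ex1 | | rewrite pvalE !pval_simp; lia].
Qed.

Lemma ptime_negb : ptime e D (fun x => enc_bool (b x)) -> ptime e D (fun x => enc_bool (~~ b x)).
Proof.
move=> Hb; apply: (eq_ptime (f := fun x => if b x then Leaf else ttrue)).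
  by move=> x _; case: (b x).
by apply: ptime_if => //; [apply: ptime_leaf | apply: ptime_true].
Qed.

Lemma ptime_andb c : ptime e D (fun x => enc_bool (b x)) -> 
  ptime e D (fun x => enc_bool (c x)) -> ptime e D (fun x => enc_bool (b x && c x)).
Proof.
move=> Hb Hc; apply: (eq_ptime (f := fun x => if b x then enc_bool (c x) else Leaf)).
  by move=> x _; case: (b x).
apply: ptime_if => //; last exact: ptime_leaf.
by apply: polytime_sub Hc => // x [].
Qed.

Lemma ptime_orb c : ptime e D (fun x => enc_bool (b x)) -> 
  ptime e D (fun x => enc_bool (c x)) -> ptime e D (fun x => enc_bool (b x || c x)).
Proof.
move=> Hb Hc; apply: (eq_ptime (f := fun x => if b x then ttrue else enc_bool (c x))).
  by move=> x _; case: (b x).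
apply: ptime_if => //; first exact: ptime_true.
by apply: polytime_sub Hc => // x [].
Qed.

End If.

(** * Loops on states that do not grow *)

Section While.
Variables (X : Type) (e : X -> tree) (D : X -> Prop).
Variables (b : X -> bool) (g : X -> X) (m : X -> nat).
Hypothesis b_ptime : ptime e D (fun x => enc_bool (b x)).
Hypothesis g_ptime : ptime e (fun x => D x /\ b x) (e \o g).
Hypothesis g_dom : forall x, D x -> b x -> D (g x).
Hypothesis m_dec : forall x, D x -> b x -> m (g x) < m x.
Hypothesis m_size : forall x, D x -> m x <= tree_size (e x).
Hypothesis size_noninc :
  forall x, D x -> b x -> tree_size (e (g x)) <= tree_size (e x).

(** With [N] the initial length, [size_noninc] keeps the cost of every pass below one bound [B], and
    [m_size] allows at most [N] passes; with the final test this gives [(N + 1) * B]. The outcome is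
    a relation because the number of passes is not known in advance. *)
Lemma polytime_while :
  polytime e D (fun x t => exists2 y,
    exists i, [/\ forall j, j < i -> b (iter j g x), ~~ b (iter i g x)
                & y = iter i g x]
    & t = e y).
Proof.
have [p [q Hp]] := ptimeE b_ptime; have [p' [q' Hp']] := ptimeE g_ptime.
exists (PWhile p p'), (('X + 1%N%:P) * (q + q' + 'X))%R => x Dx.
rewrite pvalE !pval_simp; set N := tree_size (e x).
pose B := pval q N + pval q' N + N.
(* [N] and [B] stay those of the start of the loop while the induction moves [y]. *)
suff H j y : D y -> tree_size (e y) <= N -> m y <= j -> exists t k,
    [/\ exec (PWhile p p') (e y) t k,
        exists2 z, exists i, [/\ forall j, j < i -> b (iter j g y),
          ~~ b (iter i g y) & z = iter i g y] & t = e z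
      & k <= (j + 1) * B].
  exact: (H N x Dx (leqnn _) (m_size Dx)).
elim: j y => [|j IH] y Dy leN lem; have [k /= ex lek] := Hp y Dy;
    have := leq_pval q leN; have := leq_pval q' leN;
    case by_: (b y) ex => ex leq1 leq2.
- by have := m_dec Dy by_; lia.
- exists (e y), (k + tree_size (e y)); split; first exact: exec_while_stop.
    by exists y => //; exists 0; split; rewrite /= ?by_.
  by rewrite /B; lia.
- have [l ex1 lel] := Hp' y (conj Dy by_).
  have [] := IH (g y) (g_dom Dy by_).
  + by rewrite (leq_trans (size_noninc Dy by_)).
  + by have := m_dec Dy by_; lia.
  move=> t [k' [ex2 [z [i [H1 H2 H3]] tz] lek']].
  exists t, (k + l + k' + tree_size (e y)); split.
  + exact: exec_while_loop ex ex1 ex2.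
  + exists z => //; exists i.+1; rewrite iterSr; split=> // -[|j'] //= Hj.
    by rewrite -iterS iterSr H1.
  + by rewrite -[j.+1]addn1 [_ * B]mulnDl mul1n; rewrite {2}/B; lia.
- exists (e y), (k + tree_size (e y)); split; first exact: exec_while_stop.
    by exists y => //; exists 0; split; rewrite /= ?by_.
  suff : B <= (j.+1 + 1) * B by rewrite {1}/B; lia.
  by rewrite leq_pmull ?addn1.
Qed.

(** Being constant along the loop and equal to the encoding where it stops, [f] is the final
    state. *)
Lemma ptime_while f :
  (forall x, D x -> b x -> f (g x) = f x) ->
  (forall x, D x -> ~~ b x -> f x = e x) -> ptime e D f.
Proof.
move=> fg fe; apply: polytime_sub polytime_while => // x t Dx.
move=> [_ [i [Hj Hi ->]] ->]; elim: i x Dx Hj Hi => [|i IH] x Dx Hj Hi.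
  by rewrite fe.
have bx : b x := Hj 0 isT.
rewrite iterSr -(fg _ Dx bx); apply: IH (g_dom Dx bx) _ _; last by rewrite -iterSr.
by move=> j ltj; rewrite -iterSr Hj.
Qed.

End While.
End Closure.

(** * Lists and binary numbers *)

Definition enc_pair (X Y : Type) (e : X -> tree) (e' : Y -> tree) (z : X * Y) :=
  Node (e z.1) (e' z.2).

Lemma ptime_nilp X (e : X -> tree) D Y (eY : Y -> tree) (l : X -> seq Y) :
  ptime e D (fun x => enc_seq eY (l x)) -> ptime e D (fun x => enc_bool (nilp (l x))).
Proof.
move=> Hl; apply: (ptime_eq _ Hl (ptime_leaf _ _)) => x _.
by case: (l x) => [|y s]; constructor.
Qed.

Lemma enc_seq_map Y Z (eZ : Z -> tree) (h : Y -> Z) l :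
  enc_seq eZ (map h l) = enc_seq (eZ \o h) l.
Proof. by elim: l => //= y l ->. Qed.

Lemma tree_size_enc_seq Y (eY : Y -> tree) l : size l < tree_size (enc_seq eY l).
Proof. by elim: l => //= y l; have := tree_size_gt0 (eY y); lia. Qed.

Lemma tree_size_enc_seq_filter Y (eY : Y -> tree) (a : pred Y) l :
  tree_size (enc_seq eY [seq y <- l | a y]) <= tree_size (enc_seq eY l).
Proof. by elim: l => //= y l; case: (a y) => /=; lia. Qed.

Section Lists.
Variables (X : Type) (e : X -> tree) (D : X -> Prop).

Section MapFilter.
Variables (Y Z : Type) (eY : Y -> tree) (eZ : Z -> tree) (y0 : Y).
Variables (P : X -> Y -> bool) (h : Y -> Z).
Hypothesis P_ptime : ptime (enc_pair e eY) (fun z => D z.1)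
  (fun z => enc_bool (P z.1 z.2)).
Hypothesis h_ptime : ptime eY (fun=> True) (eZ \o h).
Hypothesis h_size : forall y, tree_size (eZ (h y)) <= tree_size (eY y).

Let st := (X * (seq Y * seq Z))%type.
Let est : st -> tree := enc_pair e (enc_pair (enc_seq eY) (enc_seq eZ)).
Let step (s : st) : st :=
  (s.1, (behead s.2.1, let y := head y0 s.2.1 in
    if P s.1 y then h y :: s.2.2 else s.2.2)).

(** Heads of the first list move to an accumulator, which reverses the order. By [h_size] moving an
    entry never lengthens the state, as the loop lemma demands. *)
Lemma ptime_rev_map_filter (l : X -> seq Y) :
  ptime e D (fun x => enc_seq eY (l x)) ->
  ptime e D (fun x => enc_seq eZ (rev [seq h y | y <- l x & P x y])).
Proof.
move=> Hl.
(* The final state as a function of an arbitrary intermediate one, hence constant along the loop. *)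
pose fin (s : st) :=
  est (s.1, ([::], catrev [seq h y | y <- s.2.1 & P s.1 y] s.2.2)).
suff Hfin : ptime est (fun s => D s.1) fin.
  pose i x : st := (x, (l x, [::])).
  have Hi : ptime e D (est \o i).
    exact: ptime_pair (ptime_id _ _) (ptime_pair Hl (ptime_leaf _ _)).
  have := ptime_comp (D' := fun s => D s.1) Hi (fun x Dx => Dx) Hfin.
  by move/ptime_tl/ptime_tl; apply: eq_ptime.
have id_ D' : ptime est D' est by apply: ptime_id.
have e_ D' : ptime est D' (fun s => e s.1) by apply: ptime_hd (id_ D').
have l_ D' : ptime est D' (fun s => enc_seq eY s.2.1).
  exact: ptime_hd (ptime_tl (id_ D')).
have acc_ D' : ptime est D' (fun s => enc_seq eZ s.2.2).
  exact: ptime_tl (ptime_tl (id_ D')).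
pose b (s : st) := ~~ nilp s.2.1.
(* Where [b] holds the list is nonempty, so the default [y0] never shows, and the explicit cons lets
   head and tail be read off. *)
have cons_ : ptime est (fun s => D s.1 /\ b s) (fun s => enc_seq eY
    (head y0 s.2.1 :: behead s.2.1)).
  by apply: eq_ptime (l_ _) => -[x [[|y s] acc]] [].
have hd_ := ptime_hd cons_.
apply: (@ptime_while st est (fun s => D s.1) b step (fun s => size s.2.1)).
- exact: ptime_negb (ptime_nilp (l_ _)).
- apply: ptime_pair => //; apply: ptime_pair; first exact: ptime_tl cons_.
  apply: (eq_ptime (f := fun s : st => if P s.1 (head y0 s.2.1)
    then enc_seq eZ (h (head y0 s.2.1) :: s.2.2) else enc_seq eZ s.2.2)).
    by move=> s _ /=; case: P.
  apply: ptime_if => //.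
  + apply: (ptime_comp (h := fun s : st => (s.1, head y0 s.2.1)) _ _ P_ptime).
      exact: ptime_pair.
    by move=> s [].
  + apply: ptime_pair => //.
    apply: (ptime_comp (h := fun s : st => head y0 s.2.1) _ _ h_ptime) => //.
    by apply: polytime_sub hd_ => // s [].
- by [].
- by move=> [x [[|y s] acc]].
- move=> [x [s acc]] _ /=; have := tree_size_enc_seq eY s; lia.
- move=> [x [[|y s] acc]] //= _ _; have := h_size y.
  by case: P => /=; lia.
- move=> [x [[|y s] acc]] //= _ _; rewrite /fin /=.
  by case: P.
- by move=> [x [[|y s] acc]].
Qed.

End MapFilter.

Lemma ptime_rev Y (eY : Y -> tree) (y0 : Y) (l : X -> seq Y) :
  ptime e D (fun x => enc_seq eY (l x)) ->
  ptime e D (fun x => enc_seq eY (rev (l x))).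
Proof.
move=> Hl; have := ptime_rev_map_filter y0 (P := fun _ _ => true) (h := id)
  (ptime_true _ _) (ptime_id _ _) (fun=> leqnn _) Hl.
by apply: eq_ptime => x _; rewrite map_id filter_predT.
Qed.

(** Encodings are compared literally, order included; a second reversal restores it. *)
Lemma ptime_map_filter Y Z (eY : Y -> tree) (eZ : Z -> tree) (y0 : Y) 
    (P : X -> Y -> bool) (h : Y -> Z) (l : X -> seq Y) :
  ptime e D (fun x => enc_seq eY (l x)) ->
  ptime (enc_pair e eY) (fun z => D z.1) (fun z => enc_bool (P z.1 z.2)) ->
  ptime eY (fun=> True) (eZ \o h) ->
  (forall y, tree_size (eZ (h y)) <= tree_size (eY y)) ->
  ptime e D (fun x => enc_seq eZ [seq h y | y <- l x & P x y]).
Proof.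
move=> Hl HP Hh le_h.
have := ptime_rev (h y0) (ptime_rev_map_filter y0 HP Hh le_h Hl).
by apply: eq_ptime => x _; rewrite revK.
Qed.

Lemma ptime_filter Y (eY : Y -> tree) (y0 : Y) (P : X -> Y -> bool) (l : X -> seq Y) :
  ptime e D (fun x => enc_seq eY (l x)) ->
  ptime (enc_pair e eY) (fun z => D z.1) (fun z => enc_bool (P z.1 z.2)) ->
  ptime e D (fun x => enc_seq eY [seq y <- l x | P x y]).
Proof.
move=> Hl HP; have := ptime_map_filter y0 (h := id) Hl HP (ptime_id _ _)
  (fun=> leqnn _).
by apply: eq_ptime => x _; rewrite map_id.
Qed.

Lemma ptime_has Y (eY : Y -> tree) (y0 : Y) (P : X -> Y -> bool) (l : X -> seq Y) :
  ptime e D (fun x => enc_seq eY (l x)) ->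
  ptime (enc_pair e eY) (fun z => D z.1) (fun z => enc_bool (P z.1 z.2)) ->
  ptime e D (fun x => enc_bool (has (P x) (l x))).
Proof.
move=> Hl HP; have /ptime_nilp/ptime_negb := ptime_filter y0 Hl HP.
by apply: eq_ptime => x _; rewrite /nilp size_filter has_count lt0n.
Qed.

End Lists.

(** * Comparison of binary numbers and the threshold 1/2 *)

Fixpoint pos_bits (p : positive) : seq bool :=
  match p with
  | xH => [::]
  | xO p' => false :: pos_bits p'
  | xI p' => true :: pos_bits p'
  end.

(** The base value 1 is the implicit leading bit: the empty list stands for 1, and zero has to be
    treated apart. *)
Definition bits_val (l : seq bool) : nat := foldr (fun (b : bool) n => b + n.*2) 1 l.

Definition nat_bits (n : nat) : seq bool :=
  if bin_of_nat n is Npos p then pos_bits p else [::].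

Lemma enc_pos_bits p : enc_pos p = enc_seq enc_bool (pos_bits p).
Proof. by elim: p => //= p ->. Qed.

Lemma pos_bits_val p : bits_val (pos_bits p) = nat_of_pos p.
Proof. by elim: p => //= p ->; rewrite /= NatTrec.doubleE. Qed.

Lemma enc_nat_bits n :
  enc_nat n = if n == 0 then Leaf else Node Leaf (enc_seq enc_bool (nat_bits n)).
Proof.
rewrite -{2}(bin_of_natK n) /enc_nat /nat_bits; case: bin_of_nat => //= p.
suff /negbTE-> : nat_of_pos p != 0 by rewrite enc_pos_bits.
by rewrite -pos_bits_val; elim: p => //= p IH; lia.
Qed.

Lemma nat_bitsK n : 0 < n -> bits_val (nat_bits n) = n.
Proof.
rewrite -{1 3}(bin_of_natK n) /nat_bits; case: bin_of_nat => //= p _.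
exact: pos_bits_val.
Qed.

Lemma enc_seq_inj Y (eY : Y -> tree) : injective eY -> injective (enc_seq eY).
Proof. by move=> inj; elim=> [|y s IH] [|y' s'] //= [/inj -> /IH ->]. Qed.

Lemma enc_bool_inj : injective enc_bool.
Proof. by case; case. Qed.

Lemma enc_nat_inj : injective enc_nat.
Proof.
move=> m n; rewrite !enc_nat_bits; case: eqVneq => [->|m0]; case: eqVneq => [->|n0] //.
case=> /(enc_seq_inj enc_bool_inj) /(congr1 bits_val).
by rewrite !nat_bitsK // lt0n.
Qed.

Lemma ptime_eq_nat X (e : X -> tree) D (m n : X -> nat) :
  ptime e D (enc_nat \o m) -> ptime e D (enc_nat \o n) ->
  ptime e D (fun x => enc_bool (m x == n x)).
Proof.
move=> Hm Hn; apply: (ptime_eq _ Hm Hn) => x _.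
by apply: (iffP eqP) => [|/enc_nat_inj] //= ->.
Qed.

(* Bits are read from the least significant one; [r] tells whether the part
   of the first number already read is at most that of the second. *)
Fixpoint bits_cmp (r : bool) (a b : seq bool) : bool * (seq bool * seq bool) :=
  match a, b with
  | i :: a', j :: b' => bits_cmp (if i == j then r else j) a' b'
  | _, _ => (r, (a, b))
  end.

(** A higher bit overrides the verdict of the lower ones. When only one list runs out, its number is
    the smaller one because of the implicit leading bit. *)
Lemma bits_cmpP r a b (z := bits_cmp r a b) :
  (if nilp z.2.1 then (if nilp z.2.2 then z.1 else true) else false) =
  if r then bits_val a <= bits_val b else bits_val a < bits_val b.
Proof.
have val_gt0 l : 0 < bits_val l by elim: l => //= i l; lia.
rewrite {}/z; elim: a b r => [|i a IH] [|j b] r /=.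
- by case: r.
- by have := val_gt0 b; case: r; lia.
- by have := val_gt0 a; case: r; lia.
- by rewrite IH; case: i; case: j; case: r => /=; lia.
Qed.

Lemma ptime_leq_bits X (e : X -> tree) D (a b : X -> seq bool) :
  ptime e D (enc_seq enc_bool \o a) -> ptime e D (enc_seq enc_bool \o b) ->
  ptime e D (fun x => enc_bool (bits_val (a x) <= bits_val (b x))).
Proof.
move=> Ha Hb; pose st := (bool * (seq bool * seq bool))%type.
pose est : st -> tree := enc_pair enc_bool (enc_pair (enc_seq enc_bool) (enc_seq enc_bool)).
have id_ D' : ptime est D' est by apply: ptime_id.
have r_ D' : ptime est D' (fun s => enc_bool s.1) by apply: ptime_hd (id_ D').
have a_ D' : ptime est D' (fun s => enc_seq enc_bool s.2.1).
  exact: ptime_hd (ptime_tl (id_ D')).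
have b_ D' : ptime est D' (fun s => enc_seq enc_bool s.2.2).
  exact: ptime_tl (ptime_tl (id_ D')).
pose more (s : st) := ~~ nilp s.2.1 && ~~ nilp s.2.2.
pose hda (s : st) := head false s.2.1; pose hdb (s : st) := head false s.2.2.
have consa : ptime est (fun s => True /\ more s) (fun s => enc_seq enc_bool
    (hda s :: behead s.2.1)).
  by apply: eq_ptime (a_ _) => -[r [[|i l] l']] [].
have consb : ptime est (fun s => True /\ more s) (fun s => enc_seq enc_bool
    (hdb s :: behead s.2.2)).
  by apply: eq_ptime (b_ _) => -[r [[|i l] [|j l']]] [].
pose step (s : st) : st :=
  (if hda s == hdb s then s.1 else hdb s, (behead s.2.1, behead s.2.2)).
have cmp_ptime : ptime est (fun=> True) (fun s => est (bits_cmp s.1 s.2.1 s.2.2)).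
  apply: (@ptime_while st est (fun=> True) more step (fun s => size s.2.1)) => //.
  - exact: ptime_andb (ptime_negb (ptime_nilp (a_ _))) (ptime_negb (ptime_nilp (b_ _))).
  - apply: ptime_pair; last exact: ptime_pair (ptime_tl consa) (ptime_tl consb).
    apply: (eq_ptime (f := fun s => if hda s == hdb s then enc_bool s.1
      else enc_bool (hdb s))); first by move=> s _ /=; case: eqP.
    apply: ptime_if => //.
      apply: (ptime_eq _ (ptime_hd consa) (ptime_hd consb)) => s _.
      by apply: (iffP eqP) => [->|/enc_bool_inj].
    by apply: polytime_sub (ptime_hd consb) => // s [].
  - by move=> [r [[|i l] l']].
  - by move=> [r [l l']] _ /=; have := tree_size_enc_seq enc_bool l; lia.
  (* Raising the flag from false to true costs two units, paid for by the two list cells that are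
     dropped. *)
  - by move=> [r [[|i l] [|j l']]] //= _ _; case: r; case: i; case: j => /=; lia.
  - by move=> [r [[|i l] [|j l']]].
  - by move=> [r [[|i l] [|j l']]].
pose out (s : st) := if nilp s.2.1 then (if nilp s.2.2 then s.1 else true) else false.
have out_ptime : ptime est (fun=> True) (enc_bool \o out).
  apply: (eq_ptime (f := fun s => if nilp s.2.1 then
    (if nilp s.2.2 then enc_bool s.1 else ttrue) else Leaf)).
    by move=> [r [[|i l] [|j l']]].
  apply: ptime_if; [exact: ptime_nilp (a_ _)| |exact: ptime_leaf].
  by apply: ptime_if => //; [apply: ptime_nilp (b_ _) | apply: ptime_true].
(* The initial verdict [true] makes the comparison non-strict. *)
have Hab : ptime e D (est \o fun x => (true, (a x, b x))).
  exact: ptime_pair (ptime_true _ _) (ptime_pair Ha Hb).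
have := ptime_comp (D' := fun=> True) Hab (fun _ _ => I)
  (ptime_comp (D' := fun=> True) cmp_ptime (fun _ _ => I) out_ptime).
by apply: eq_ptime => x _; rewrite /= /out bits_cmpP.
Qed.

(** The denominator is positive and can be cleared. The test [n != 0] isolates the numerators that
    have a bit list. *)
Lemma half_le_ratE (q : rat) : (1 / 2 <= q)%R =
  if numq q is Posz n then (n != 0) && (`|denq q| <= n.*2) else false.
Proof.
rewrite mul1r -[q in LHS]divq_num_den.
have d0 := denq_gt0 q; rewrite ler_pdivlMr ?ltr0z // mulrC.
rewrite ler_pdivrMr // (_ : 2 = 2%:Z%:~R)%R // -intrM ler_int.
by case: (numq q) => n; lia.
Qed.

Lemma ptime_half_le : ptime enc_rat (fun=> True) (fun q => enc_bool (1 / 2 <= q)%R).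
Proof.
have id_ D' : ptime enc_rat D' enc_rat by apply: ptime_id.
have num_ D' : ptime enc_rat D' (fun q => enc_int (numq q)) by apply: ptime_hd (id_ D').
have den_ D' : ptime enc_rat D' (fun q => Node Leaf (enc_seq enc_bool (nat_bits `|denq q|))).
  apply: eq_ptime (ptime_tl (id_ D')) => q _.
  by rewrite enc_nat_bits; have := denq_gt0 q; case: eqP => //; lia.
have num'_ D' : ptime enc_rat D' (fun q => Node (enc_bool (numq q < 0)%R) (enc_nat `|numq q|)).
  by apply: eq_ptime (num_ D') => q _; case: (numq q).
(* Prepending a zero as least significant bit doubles the numerator. *)
apply: (eq_ptime (f := fun q => if (numq q < 0)%R then Leaf else
  if `|numq q|%N == 0 then Leaf else
  enc_bool (bits_val (nat_bits `|denq q|) <= bits_val (false :: nat_bits `|numq q|)))).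
  move=> q _; rewrite half_le_ratE /= add0n nat_bitsK; last by have := denq_gt0 q; lia.
  case: (numq q) => //= n; case: eqP => //= n0.
  by rewrite nat_bitsK // lt0n; apply/eqP.
apply: ptime_if; [exact: ptime_hd (num'_ _)|exact: ptime_leaf|].
apply: ptime_if; [|exact: ptime_leaf|].
  apply: (ptime_eq _ (ptime_tl (num'_ _)) (ptime_leaf _ _)) => q _.
  by rewrite enc_nat_bits; case: eqP => _; constructor.
apply: ptime_leq_bits; first exact: ptime_tl (den_ _).
apply: ptime_pair; first exact: ptime_leaf.
suff H : ptime enc_rat (fun q => (True /\ ~~ (numq q < 0)%R) /\ `|numq q|%N != 0)
    (fun q => Node Leaf (enc_seq enc_bool (nat_bits `|numq q|))).
  exact: ptime_tl H.
apply: eq_ptime (ptime_tl (num'_ _)) => q [_ n0].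
by rewrite enc_nat_bits (negbTE n0).
Qed.

(** * Testing for cycles *)

Definition touches (v : nat) (f : nat * nat) : bool := (f.1 == v) || (f.2 == v).

Definition other_edge (E : seq (nat * nat)) (e : nat * nat) (v : nat) : bool :=
  has (fun f => (f != e) && touches v f) E.

(** Another edge at each end expresses degree at least two without counting; judging all edges
    against the same list makes a round a single filter. *)
Definition prune (E : seq (nat * nat)) : seq (nat * nat) :=
  [seq e <- E | other_edge E e e.1 && other_edge E e e.2].

Definition prune_all (E : seq (nat * nat)) : seq (nat * nat) :=
  iter (size E) prune E.

(* Every round that changes the list shortens it, so [size E] rounds reach a
   fixed point. *)
Lemma prune_all_fixed E : prune (prune_all E) = prune_all E.
Proof.
rewrite /prune_all; suff H k : (prune (iter k prune E) = iter k prune E) \/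
    size (iter k prune E) + k <= size E.
  have [//|] := H (size E).
  by rewrite -[leqRHS]add0n leq_add2r leqn0 => /nilP->.
elim: k => [|k [IH|IH]] /=; [by right; rewrite addn0 | by left; rewrite !IH |].
set F := iter k prune E in IH *.
have := size_filter (fun e => other_edge F e e.1 && other_edge F e e.2) F.
have := count_size (fun e => other_edge F e e.1 && other_edge F e e.2) F.
rewrite leq_eqVlt => /orP[/eqP eqF _|]; last by rewrite /prune; right; lia.
suff FF : prune F = F by left; rewrite !FF.
by apply/all_filterP; rewrite all_count eqF.
Qed.

Lemma prune_all_sub E : {subset prune_all E <= E}.
Proof.
rewrite /prune_all => e; elim: (size E) => //= k IH.
by rewrite mem_filter => /andP[_ /IH].
Qed.

(* A simple path that cannot be extended beyond its first vertex [x] closes a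
   cycle through the neighbour of [x] that is not its successor. *)
Lemma two_neighbours_cycle (T : finType) (r : rel T) a b :
  symmetric r -> irreflexive r ->
  (forall u v, r u v -> exists2 w, r u w & w != v) -> r a b ->
  exists2 s, ucycle r s & 2 < size s.
Proof.
move=> r_sym r_irr nbr rab.
(* The path has [size p + 2] distinct vertices, so [k] can never be 0 and bounds the number of
   extensions. *)
suff H k x y p : #|T| - size p <= k -> uniq [:: x, y & p] -> path r x (y :: p) ->
    exists2 s, ucycle r s & 2 < size s.
  apply: (H _ a b [::] (leqnn _)) => /=; last by rewrite rab.
  by rewrite !inE andbT; apply: contraTneq rab => ->; rewrite r_irr.
elim: k x y p => [|k IH] x y p szp Up rp.
  have := max_card (mem [:: x, y & p]); rewrite (card_uniqP Up) /=.
  move: szp; rewrite leqn0 subn_eq0 => szp /leq_trans/(_ szp).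
  by rewrite ltnNge leqnSn.
have /andP[rxy ryp] : r x y && path r y p by [].
have [w rxw w_y] := nbr x y rxy.
case: (boolP (w \in [:: x, y & p])) => [|w_new]; last first.
  apply: (IH w x (y :: p)); first by move: szp => /=; lia.
    by rewrite cons_uniq w_new.
  by rewrite /= r_sym rxw.
rewrite !inE (negbTE w_y) orFb orbC; case: eqVneq => [wx|_ /=].
  by rewrite wx r_irr in rxw.
(* Here [w] differs from [x] and [y], hence lies in [p], and the segment from [x] to [w] has at
   least three vertices. *)
rewrite orbF => /splitPr p_w; case: p_w Up ryp => p1 p2 Up ryp {szp rp}.
exists [:: x, y & rcons p1 w]; last by rewrite /= size_rcons.
apply/andP; split.
  rewrite /= rxy rcons_path last_rcons r_sym rxw andbT.
  by move: ryp; rewrite -cat_rcons cat_path => /andP[].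
by move: Up; rewrite -cat_rcons -!cat_cons cat_uniq => /andP[].
Qed.

(** After rotating [s] to start at [u] this compares its first and third entries. It shows that
    consecutive edges of a cycle are distinct, so that each protects the other from pruning. *)
Lemma next_next_neq (T : eqType) (s : seq T) u :
  uniq s -> 2 < size s -> u \in s -> next s (next s u) != u.
Proof.
move=> Us szs us; case: (rot_to us) => i s' rot_s.
rewrite -!(next_rot i Us) rot_s.
have Us' : uniq (u :: s') by rewrite -rot_s rot_uniq.
have : 2 < size (u :: s') by rewrite -rot_s size_rot.
case: s' {rot_s} Us' => [|v [|w s']] //= Us' _.
move: Us'; rewrite !inE !negb_or => /and4P[/and3P[uv uw _] /andP[vw _] _ _].
by rewrite eqxx (eq_sym v u) (negbTE uv) eqxx eq_sym.
Qed.

Section CycleTest.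
Variables (n : nat) (H : sgraph 'I_n).

(** Plain numbers replace ordinals because the encoding forgets the ambient bound; programs see only
    vertex names. *)
Definition edge_list : seq (nat * nat) :=
  [seq (val e.1, val e.2) |
     e <- enum [pred e : 'I_n * 'I_n | (e.1 < e.2) && adj H e.1 e.2]].

Lemma mem_edge_list (u v : 'I_n) :
  ((val u, val v) \in edge_list) = (u < v) && adj H u v.
Proof.
apply/mapP/idP => [[[u' v']]|uv].
  by rewrite mem_enum inE /= => uv [/val_inj -> /val_inj ->].
by exists (u, v); rewrite // mem_enum inE.
Qed.

Lemma edge_listP e : e \in edge_list ->
  exists u v : 'I_n, [/\ e = (val u, val v), u < v & adj H u v].
Proof.
case/mapP=> -[u v]; rewrite mem_enum inE /= => /andP[ltuv auv] ->.
by exists u, v.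
Qed.

Let E := prune_all edge_list.
Let r : rel 'I_n := fun u v => ((val u, val v) \in E) || ((val v, val u) \in E).

Let r_adj : subrel r (adj H).
Proof.
move=> u v /orP[] /prune_all_sub; rewrite mem_edge_list => /andP[_] //.
by rewrite adj_sym.
Qed.

(** Listed edges have their smaller end first, so another edge at [u] with far end [v] would
    coincide with [e]. *)
Let other_edge_nbr u v e : e \in E ->
  e = (val u, val v) \/ e = (val v, val u) -> other_edge E e (val u) ->
  exists2 w, r u w & w != v.
Proof.
move=> eE uv /hasP[f fE /andP[fe fu]].
have [a [b [fab ltab _]]] := edge_listP (prune_all_sub fE).
have [c [d [ecd ltcd _]]] := edge_listP (prune_all_sub eE).
move: fu; rewrite /touches fab /= => /orP[] /eqP/val_inj ?; subst.
  exists b; rewrite /r ?fE //; apply: contraNneq fe => ?; subst.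
  by case: uv ltcd => -[/val_inj -> /val_inj ->] //; rewrite ltnNge ltnW.
exists a; rewrite /r ?fE ?orbT //; apply: contraNneq fe => ?; subst.
by case: uv ltcd => -[/val_inj -> /val_inj ->] //; rewrite ltnNge ltnW.
Qed.

Let r_nbr u v : r u v -> exists2 w, r u w & w != v.
Proof.
have fixE e : e \in E -> other_edge E e e.1 && other_edge E e e.2.
  by rewrite -{1}[E]prune_all_fixed mem_filter => /andP[].
case/orP=> uvE; have /andP[o1 o2] := fixE _ uvE.
  by apply: (other_edge_nbr uvE _ o1); left.
by apply: (other_edge_nbr uvE _ o2); right.
Qed.

(** The form in which an edge between [u] and [v] is listed. *)
Let medge (u v : 'I_n) : nat * nat :=
  if u < v then (val u, val v) else (val v, val u).

Let medge_neq u v w : u != w -> medge u v != medge v w.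
Proof.
move=> uw; rewrite /medge; apply: contraNneq uw.
by case: ltnP => _; case: ltnP => _ [] *; apply/eqP/val_inj => /=; congruence.
Qed.

Let touches_medge u v :
  (touches (val u) (medge u v)) * (touches (val v) (medge u v)) : Prop.
Proof. by rewrite /medge /touches; case: ltnP; rewrite /= !eqxx ?orbT. Qed.

(** All edges of the cycle survive a round together: the edge leaving [u] is protected at [u] by the
    one entering it, and at its other end by the next one. *)
Let prune_all_cycle s u : ucycle (adj H) s -> 2 < size s -> u \in s ->
  medge u (next s u) \in E.
Proof.
move=> /andP[adj_s Us] szs; rewrite /E /prune_all.
elim: (size _) u => [|k IH] u us.
  have := next_cycle adj_s us => auv /=; rewrite /medge.
  case: ltnP => uv; rewrite mem_edge_list ?uv // adj_sym auv andbT.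
  by rewrite ltn_neqAle uv andbT; apply: contraTneq auv => /val_inj ->; rewrite adj_irr.
rewrite /= mem_filter IH // andbT.
set F := iter k prune edge_list in IH *.
have pu : other_edge F (medge u (next s u)) (val u).
  have := IH (prev s u); rewrite mem_prev us next_prev // => /(_ isT) fF.
  apply/hasP; exists (medge (prev s u) u); rewrite // touches_medge andbT.
  apply: medge_neq; apply: contra_neq (next_next_neq Us szs us) => <-.
  by rewrite next_prev.
have pv : other_edge F (medge u (next s u)) (val (next s u)).
  have fF := IH (next s u); rewrite mem_next us in fF.
  apply/hasP; exists (medge (next s u) (next s (next s u))); first exact: fF.
  rewrite touches_medge andbT eq_sym; apply: medge_neq.
  by rewrite eq_sym next_next_neq.
by rewrite {2 4}/medge; case: ltnP => _ /=; rewrite pu pv.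
Qed.

Lemma has_cycleP : reflect (has_cycle H) (~~ nilp (prune_all edge_list)).
Proof.
apply: (iffP idP) => [|[s s_cycle sz_s]]; last first.
  case: s s_cycle sz_s => // u s s_cycle sz_s.
  by have := prune_all_cycle s_cycle sz_s (mem_head u s); rewrite /E; case: prune_all.
rewrite -/E; case defE : E => [|e F] // _.
have eE : e \in E by rewrite defE mem_head.
have [u [v [euv ltuv auv]]] := edge_listP (prune_all_sub eE).
have [|||s /andP[s_cycle Us] sz_s] := two_neighbours_cycle (r := r) (a := u) (b := v) _ _ r_nbr.
- by move=> x y; rewrite /r orbC.
- by move=> x; apply/negP => /r_adj; rewrite adj_irr.
- by rewrite /r -euv eE.
by exists s => //; rewrite /ucycle (sub_cycle r_adj).
Qed.

End CycleTest.

(** * Pruning in polynomial time *)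

Definition enc_edge : nat * nat -> tree := enc_pair enc_nat enc_nat.

Lemma ptime_prune : ptime (enc_seq enc_edge) (fun=> True) (enc_seq enc_edge \o prune).
Proof.
have other_ v : ptime (enc_pair (enc_seq enc_edge) enc_edge) (fun=> True) (enc_nat \o v) ->
    ptime (enc_pair (enc_seq enc_edge) enc_edge) (fun=> True)
      (fun z => enc_bool (other_edge z.1 z.2 (v z))).
  move=> v_; set e2 := enc_pair (enc_seq enc_edge) enc_edge.
  apply: (@ptime_has _ _ _ _ enc_edge (0, 0)); first exact: ptime_hd (ptime_id e2 _).
  have id_ : ptime (enc_pair e2 enc_edge) (fun=> True) (enc_pair e2 enc_edge).
    exact: ptime_id.
  have f_ : ptime (enc_pair e2 enc_edge) (fun=> True) (fun z => enc_edge z.2).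
    exact: ptime_tl id_.
  have e_ : ptime (enc_pair e2 enc_edge) (fun=> True) (fun z => enc_edge z.1.2).
    exact: ptime_tl (ptime_hd id_).
  have v'_ : ptime (enc_pair e2 enc_edge) (fun=> True) (fun z => enc_nat (v z.1)).
    apply: (ptime_comp (h := fst) (e' := e2) (D' := fun=> True) _ _ v_) => //.
    exact: ptime_hd id_.
  apply: ptime_andb.
    apply: ptime_negb; apply: (ptime_eq _ f_ e_) => z _.
    apply: (iffP eqP) => [->|] //; case: z.1.2 z.2 => a b [c d] [/enc_nat_inj -> /enc_nat_inj ->] //.
  by apply: ptime_orb; apply: ptime_eq_nat => //; [apply: ptime_hd f_ | apply: ptime_tl f_].
apply: (ptime_filter (0, 0)); first exact: ptime_id.
apply: ptime_andb; apply: other_.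
  exact: ptime_hd (ptime_tl (ptime_id _ _)).
exact: ptime_tl (ptime_tl (ptime_id _ _)).
Qed.

(** A second copy of the list serves as a unary clock, losing one entry per round. *)
Lemma ptime_prune_all X (e : X -> tree) D (E : X -> seq (nat * nat)) :
  ptime e D (fun x => enc_seq enc_edge (E x)) ->
  ptime e D (fun x => enc_seq enc_edge (prune_all (E x))).
Proof.
move=> HE; pose est := enc_pair (enc_seq enc_edge) (enc_seq enc_edge).
have id_ D' : ptime est D' est by apply: ptime_id.
have it_ : ptime est (fun=> True) (fun s => est (iter (size s.2) prune s.1, [::])).
  apply: (@ptime_while _ est (fun=> True) (fun s => ~~ nilp s.2)
    (fun s => (prune s.1, behead s.2)) (fun s => size s.2)) => //.
  - exact: ptime_negb (ptime_nilp (ptime_tl (id_ _))).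
  - apply: ptime_pair.
      apply: (ptime_comp (h := fst) _ _ ptime_prune) => //.
      exact: ptime_hd (id_ _).
    apply: (@ptime_tl _ _ _ (fun s => enc_edge (head (0, 0) s.2))).
    by apply: eq_ptime (ptime_tl (id_ _)) => -[F [|f s]] [].
  - by move=> [F [|f s]].
  - by move=> [F s] _ /=; have := tree_size_enc_seq enc_edge s; lia.
  - move=> [F [|f s]] //= _ _.
    by have := tree_size_enc_seq_filter enc_edge (fun e => other_edge F e e.1 && other_edge F e e.2) F;
      rewrite /prune; lia.
  - by move=> [F [|f s]] //= _ _; rewrite -iterSr.
  - by move=> [F [|f s]].
have HEE : ptime e D (est \o fun x => (E x, E x)) by apply: ptime_pair.
exact: ptime_hd (ptime_comp HEE (fun _ _ => I) it_).
Qed.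

(** * The rounding loop *)

Definition enc_entry : nat * rat -> tree := enc_pair enc_nat enc_rat.

Definition entry0 : nat * rat := (0, 0%R).

Lemma ptime_fst X Y (e : X -> tree) (e' : Y -> tree) D f :
  ptime e D f -> ptime (enc_pair e e') (fun z => D z.1) (fun z => f z.1).
Proof.
move=> Hf; apply: (ptime_comp (h := fst) (D' := D) _ _ Hf) => //.
exact: ptime_hd (ptime_id (enc_pair e e') _).
Qed.

Definition has_key (l : seq (nat * rat)) (k : nat) : bool :=
  has (fun y => y.1 == k) l.

Lemma ptime_has_key X (e : X -> tree) D l k :
  ptime e D (fun x => enc_seq enc_entry (l x)) -> ptime e D (enc_nat \o k) ->
  ptime e D (fun x => enc_bool (has_key (l x) (k x))).
Proof.
move=> Hl Hk; apply: (ptime_has entry0 Hl); apply: ptime_eq_nat.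
  exact: ptime_hd (ptime_tl (ptime_id (enc_pair e enc_entry) _)).
exact: ptime_fst Hk.
Qed.

Section VertexLists.
Variables (n : nat) (H : sgraph 'I_n).

Definition entries (x : 'I_n -> rat) : seq (nat * rat) :=
  [seq (val u, x u) | u <- enum (vset H)].

(** Its keys are the vertices that survive the round, which is all that deletion has to look up. *)
Definition small_entries (x : 'I_n -> rat) : seq (nat * rat) :=
  [seq y <- entries x | ~~ (1 / 2 <= y.2)%R].

Lemma enc_vector_entries x : enc_vector H x = enc_seq enc_entry (entries x).
Proof. by rewrite enc_seq_map. Qed.

Lemma enc_edges_list : enc_edges H = enc_seq enc_edge (edge_list H).
Proof. by rewrite enc_seq_map. Qed.

Lemma has_key_entries x (u : 'I_n) : has_key (entries x) (val u) = (u \in vset H).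
Proof.
apply/hasP/idP => [[y /mapP[v]]|uH].
  by rewrite mem_enum => vH -> /eqP/val_inj <-.
by exists (val u, x u) => //; apply: map_f; rewrite mem_enum.
Qed.

Lemma has_key_small_entries x (u : 'I_n) :
  has_key (small_entries x) (val u) = (u \in vset H :\: rounded H x).
Proof.
apply/hasP/idP => [[y]|].
  rewrite mem_filter => /andP[ylt /mapP[v]]; rewrite mem_enum => vH yE.
  rewrite yE in ylt *; move=> /= /eqP/val_inj <-.
  by rewrite !inE vH !andbT.
rewrite !inE => /andP[+ uH]; rewrite uH /= => xu.
exists (val u, x u) => //; rewrite mem_filter xu; apply: map_f.
by rewrite mem_enum.
Qed.

End VertexLists.

(** Enumerations follow the order of the ambient type. Hence filtering the encoded lists yields
    exactly the prescribed encoding of a subgraph or subset. *)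
Lemma enum_sub (T : finType) (P Q : pred T) :
  {subset Q <= P} -> enum Q = [seq u <- enum P | Q u].
Proof.
move=> QP; rewrite /enum_mem -filter_predI; apply: eq_filter => u /=.
by apply/idP/andP => [Qu|[]//]; split=> //; apply: QP.
Qed.

Lemma entries_del n (H : sgraph 'I_n) c x :
  entries (del H (rounded H x)) c =
  [seq y <- entries H c | has_key (small_entries H x) y.1].
Proof.
rewrite filter_map /entries; congr map.
rewrite (enum_sub (P := mem (vset H))) => [|u]; last by rewrite !inE => /andP[].
by apply: eq_filter => u /=; rewrite has_key_small_entries.
Qed.

Lemma edge_list_del n (H : sgraph 'I_n) x :
  edge_list (del H (rounded H x)) =
  [seq f <- edge_list H | has_key (small_entries H x) f.1
     && has_key (small_entries H x) f.2].
Proof.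
rewrite filter_map /edge_list; congr map.
set P := [pred e : 'I_n * 'I_n | (e.1 < e.2) && adj H e.1 e.2].
have -> : enum P = [seq e <- enum P | P e].
  by apply/esym/all_filterP/allP => e; rewrite mem_enum.
rewrite -filter_predI (enum_sub (P := P)) => [|e]; last first.
  by rewrite !inE /= /del_adj => /andP[-> /and3P[_ _ ->]].
apply: eq_filter => -[u v] /=; rewrite !has_key_small_entries /del_adj !inE.
case: ltnP => //= _; case auv: (adj H u v); rewrite ?andbF //.
have vu : adj H v u by rewrite adj_sym.
by rewrite (adj_vset auv) (adj_vset vu) !andbT.
Qed.

(** The original instance is kept to recover the removed vertices at the end, so the accumulated set
    need not be stored. *)
Record state := State {
  input : instance;
  residual : sgraph 'I_(label_bound input)
}.

Definition current (z : state) : instance :=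
  Instance (residual z) (cost_of (input z)).

Definition enc_state (z : state) : tree :=
  Node (enc_instance (input z)) (enc_instance (current z)).

Definition removed (z : state) : {set 'I_(label_bound (input z))} :=
  vset (graph_of (input z)) :\: vset (residual z).

Lemma enc_instance_lists I : enc_instance I =
  Node (enc_seq enc_entry (entries (graph_of I) (cost_of I)))
       (enc_seq enc_edge (edge_list (graph_of I))).
Proof. by rewrite /enc_instance enc_vector_entries enc_edges_list. Qed.

(* The output is read off the original vertex list, whose order is that of
   [enum], as what the residual graph has lost. *)
Lemma ptime_removed :
  ptime enc_state (fun=> True) (fun z => enc_set (removed z)).
Proof.
pose orig z := entries (graph_of (input z)) (cost_of (input z)).
pose left z := entries (residual z) (cost_of (input z)).
have id_ : ptime enc_state (fun=> True) enc_state by apply: ptime_id.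
have orig_ : ptime enc_state (fun=> True) (fun z => enc_seq enc_entry (orig z)).
  apply: (@ptime_hd _ _ _ _ (fun z => enc_seq enc_edge (edge_list (graph_of (input z))))).
  by apply: eq_ptime (ptime_hd id_) => z _; rewrite enc_instance_lists.
have left_ : ptime enc_state (fun=> True) (fun z => enc_seq enc_entry (left z)).
  apply: (@ptime_hd _ _ _ _ (fun z => enc_seq enc_edge (edge_list (residual z)))).
  by apply: eq_ptime (ptime_tl id_) => z _; rewrite enc_instance_lists.
have := ptime_map_filter entry0 (eZ := enc_nat) (h := fst)
  (P := fun z y => ~~ has_key (left z) y.1) orig_.
have key_ : ptime (enc_pair enc_state enc_entry) (fun=> True) (fun z => enc_nat z.2.1).
  exact: ptime_hd (ptime_tl (ptime_id _ _)).
move=> /(_ (ptime_negb (ptime_has_key (ptime_fst enc_entry left_) key_))).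
move=> /(_ (ptime_hd (ptime_id enc_entry _))).
have fst_size y : tree_size (enc_nat y.1) <= tree_size (enc_entry y).
  by case: y => k q /=; lia.
move=> /(_ fst_size); apply: eq_ptime => z _.
rewrite /enc_set -(enc_seq_map enc_nat val); congr enc_seq.
rewrite filter_map -map_comp; congr map.
rewrite [RHS](enum_sub (P := mem (vset (graph_of (input z))))) => [|u]; last first.
  by rewrite /removed !inE => /andP[].
apply: eq_in_filter => u; rewrite mem_enum => uV.
by rewrite /= has_key_entries -[RHS]/(u \in removed z) inE uV andbT.
Qed.

(** * Running time of the rounding algorithm *)

Section Rounding.
Variables (R : realType)
  (pw : forall n : nat, sgraph 'I_n -> ('I_n -> rat) -> 'I_n -> rat).
Hypothesis pwP : forall (n : nat) (H : sgraph 'I_n) (c : 'I_n -> rat),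
  has_cycle H -> nonneg H c -> witness R H c (pw H c).
Hypothesis pw_polytime : polytime enc_instance
  (fun I => has_cycle (graph_of I) /\ nonneg (graph_of I) (cost_of I))
  (fun I t => t = enc_vector (graph_of I) (pw (graph_of I) (cost_of I))).

Local Notation x_ z := (pw (residual z) (cost_of (input z))).

Definition round (z : state) : state :=
  State (del (residual z) (rounded (residual z) (x_ z))).

Definition cyclic (z : state) : bool := ~~ nilp (prune_all (edge_list (residual z))).

Definition nonneg_costs (z : state) : Prop := nonneg (residual z) (cost_of (input z)).

Let current_lists_ptime D : ptime enc_state D (fun z =>
  Node (enc_seq enc_entry (entries (residual z) (cost_of (input z))))
       (enc_seq enc_edge (edge_list (residual z)))).
Proof.
apply: eq_ptime (ptime_tl (ptime_id enc_state D)) => z _.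
by rewrite enc_instance_lists.
Qed.

Lemma cyclic_ptime D : ptime enc_state D (fun z => enc_bool (cyclic z)).
Proof.
exact: ptime_negb (ptime_nilp (ptime_prune_all (ptime_tl (current_lists_ptime D)))).
Qed.

Lemma round_ptime :
  ptime enc_state (fun z => nonneg_costs z /\ cyclic z) (enc_state \o round).
Proof.
set D := fun z => _.
have pw_ : ptime enc_state D (fun z => enc_seq enc_entry (entries (residual z) (x_ z))).
  have Hc : ptime enc_state D (enc_instance \o current).
    exact: ptime_tl (ptime_id _ _).
  (* The loop test supplies the cycle that the time bound of the subroutine presupposes. *)
  have DD z : D z -> has_cycle (graph_of (current z)) /\
      nonneg (graph_of (current z)) (cost_of (current z)).
    by move=> [nn /has_cycleP].
  apply: eq_ptime (ptime_comp Hc DD pw_polytime) => z _.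
  exact: enc_vector_entries.
have small_ : ptime enc_state D
    (fun z => enc_seq enc_entry (small_entries (residual z) (x_ z))).
  apply: (ptime_filter entry0 pw_); apply: ptime_negb.
  apply: (ptime_comp (h := fun z => z.2.2) _ _ ptime_half_le) => //.
  exact: ptime_tl (ptime_tl (ptime_id (enc_pair enc_state enc_entry) _)).
have ent_ := ptime_hd (current_lists_ptime D).
have edg_ := ptime_tl (current_lists_ptime D).
have idv : ptime (enc_pair enc_state enc_entry) (fun z => D z.1)
    (enc_pair enc_state enc_entry) by apply: ptime_id.
have ide : ptime (enc_pair enc_state enc_edge) (fun z => D z.1)
    (enc_pair enc_state enc_edge) by apply: ptime_id.
(* The filtered list is that of the costs: the entries of the witness could be longer than those of
   the input. *)
have Hent := ptime_filter entry0
  (P := fun z y => has_key (small_entries (residual z) (x_ z)) y.1) ent_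
  (ptime_has_key (ptime_fst enc_entry small_) (ptime_hd (ptime_tl idv))).
have small'_ := ptime_fst enc_edge small_.
have Hedg := ptime_filter (0, 0) (P := fun z f =>
  has_key (small_entries (residual z) (x_ z)) f.1 &&
  has_key (small_entries (residual z) (x_ z)) f.2) edg_ (ptime_andb
  (ptime_has_key small'_ (ptime_hd (ptime_tl ide)))
  (ptime_has_key small'_ (ptime_tl (ptime_tl ide)))).
apply: ptime_pair; first exact: ptime_hd (ptime_id enc_state _).
apply: eq_ptime (ptime_pair Hent Hedg) => z _.
by rewrite enc_instance_lists /= entries_del edge_list_del.
Qed.

Lemma round_nonneg z : nonneg_costs z -> nonneg_costs (round z).
Proof. by move=> nn u; rewrite inE => /andP[_ /nn]. Qed.

Lemma round_shrinks z : nonneg_costs z -> cyclic z ->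
  #|vset (residual (round z))| < #|vset (residual z)|.
Proof.
move=> nn /has_cycleP cyc; have [_ _ [u uH xu] _] := pwP cyc nn.
apply: proper_card; apply/properP; split; first exact: subsetDl.
by exists u => //; rewrite !inE uH xu.
Qed.

Lemma card_residual z : #|vset (residual z)| <= tree_size (enc_state z).
Proof.
rewrite /enc_state !enc_instance_lists /=.
have := tree_size_enc_seq enc_entry (entries (residual z) (cost_of (input z))).
rewrite {1}/entries size_map -cardE => /ltnW/leq_trans; apply.
by lia.
Qed.

Lemma round_size z : tree_size (enc_state (round z)) <= tree_size (enc_state z).
Proof.
rewrite /enc_state !enc_instance_lists /= entries_del edge_list_del.
by rewrite !(ltnS, leq_add, leq_add2l) // tree_size_enc_seq_filter.
Qed.

Lemma iter_round I i : iter i round (State (graph_of I)) =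
  State (round_state (@pw (label_bound I)) (cost_of I) (graph_of I) i).1.
Proof. by elim: i => //= i ->. Qed.

(** Each rounded set lies in the current vertex set, so the accumulated set is exactly what the
    residual graph has lost. *)
Lemma round_state_removed n (G : sgraph 'I_n) c i
    (st := round_state (@pw n) c G i) :
  (vset st.1 \subset vset G) /\ st.2 = vset G :\: vset st.1.
Proof.
rewrite {}/st; elim: i => [|i [sub eqR]]; first by rewrite subxx setDv.
rewrite /round_state iterS -/(round_state _ _ _ _).
set st := round_state _ _ _ _ in sub eqR *; split=> /=; rewrite ?eqR.
  exact: subset_trans (subsetDl _ _) sub.
apply/setP => u; rewrite !inE; case uH: (u \in vset st.1) => /=.
  by rewrite (subsetP sub _ uH) !andbT negbK.
by rewrite ?andbF ?orbF.
Qed.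

Lemma rounding_polytime : polytime enc_instance
  (fun I => nonneg (graph_of I) (cost_of I))
  (fun I t => exists2 S : {set 'I_(label_bound I)},
     rounding_returns (@pw (label_bound I)) (cost_of I) (graph_of I) S
     & t = enc_set S).
Proof.
set D := fun I => _; pose init I := State (graph_of I).
have init_ : polytime enc_instance D
    (fun I t => exists2 z, z = init I & t = enc_state z).
  have id_ : ptime enc_instance D enc_instance by apply: ptime_id.
  have : ptime enc_instance D (enc_state \o init).
    by apply: eq_ptime (ptime_pair id_ id_) => -[].
  by apply: polytime_sub => // I t _ ->; exists (init I).
have loop_ := polytime_while (cyclic_ptime _) round_ptime
  (fun z nn _ => round_nonneg nn) round_shrinks (fun z _ => card_residual z)
  (fun z _ _ => round_size z).
have init_dom I z : D I -> z = init I -> nonneg_costs z by move=> nn ->.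
pose stops I z := exists i, [/\ forall j, j < i -> cyclic (iter j round (init I)),
  ~~ cyclic (iter i round (init I)) & z = iter i round (init I)].
have stops_ : polytime enc_instance D
    (fun I t => exists2 z, stops I z & t = enc_state z).
  by apply: polytime_sub (polytime_comp init_ init_dom loop_) => // J t _ [_ ->].
apply: polytime_sub (polytime_comp stops_ (fun _ _ _ _ => I) ptime_removed) => //.
move=> J t _ [_ [i [cyc acyc ->]] ->]; rewrite iter_round in acyc *.
have [_ eqR] := round_state_removed (graph_of J) (cost_of J) i.
exists (round_state (@pw _) (cost_of J) (graph_of J) i).2; last by rewrite eqR.
exists i; split=> //; last by move/has_cycleP; apply/negP.
by move=> j /cyc; rewrite iter_round => /has_cycleP.
Qed.

End Rounding.
Theorem lemma20 (R : realType)
    (produce_witness :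
       forall n : nat, sgraph 'I_n -> ('I_n -> rat) -> 'I_n -> rat)
    (produce_witnessP :
       forall (n : nat) (H : sgraph 'I_n) (c : 'I_n -> rat),
         has_cycle H -> nonneg H c ->
         witness R H c (produce_witness n H c))
    (produce_witness_polytime :
       polytime enc_instance
         (fun I : instance =>
            has_cycle (graph_of I) /\ nonneg (graph_of I) (cost_of I))
         (fun (I : instance) (t : tree) =>
            t = enc_vector (graph_of I)
                  (produce_witness (label_bound I) (graph_of I) (cost_of I)))) :
  polytime enc_instance
    (fun I : instance => nonneg (graph_of I) (cost_of I))
    (fun (I : instance) (t : tree) =>
       exists2 S : {set 'I_(label_bound I)},
         rounding_returns (produce_witness (label_bound I)) (cost_of I)
           (graph_of I) S
         & t = enc_set S).
Proof.
exact: rounding_polytime produce_witnessP produce_witness_polytime.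
Qed.
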